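(* Let $L$ and $M$ be semistable Euclidean lattices. If $S$ is a nonzero sublattice of $L\otimes M$ with $\operatorname{rk}(S)\le 3$, then $\mu(S)\le \mu(L\otimes M)$.
   Context: A Euclidean lattice $L$ of rank $n$ is a discrete subgroup of rank $n$ spanning an $n$-dimensional real inner product space $L_{\mathbb{R}}$. Its degree is $\deg(L)=-\log \mathrm{vol}(L_{\mathbb{R}}/L)$ (volume of a fundamental parallelepiped), its rank is $\operatorname{rk}(L)=n$, and its slope is $\mu(L)=\deg(L)/\operatorname{rk}(L)$. A sublattice $S\subseteq L$ is a subgroup, regarded as a lattice in its real span with the induced inner product. $L$ is semistable if $\mu(S)\le\mu(L)$ for every nonzero sublattice $S\subseteq L$. For lattices $L,M$, the lattice $L\otimes M\subset L_{\mathbb{R}}\otimes M_{\mathbb{R}}$ (spanned by the $u\otimes u'$, $u\in L$, $u'\in M$) carries the inner product $(v\otimes w,v'\otimes w')=(v,v')(w,w')$. *)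

(* Defs.v *)
From HB Require Import structures.
From mathcomp Require Import all_boot all_order all_algebra.
From mathcomp Require Import all_classical all_reals all_analysis.
From mathcomp Require Import mxtens.
Set Implicit Arguments. Unset Strict Implicit. Unset Printing Implicit Defensive.
Import Order.TTheory GRing.Theory Num.Theory.
Local Open Scope ring_scope.

(* A Euclidean lattice of rank n is represented (up to isometry) by a basis
   matrix B : 'M[R]_(n, N) whose rows are R-linearly independent vectors of
   R^N with the standard inner product; the lattice is the Z-span of the rows.
   Every Euclidean lattice is isometric to such a lattice. *)

Section Lattices.
Variable R : realType.

Definition in_lattice {n N : nat} (B : 'M[R]_(n, N)) (x : 'rV[R]_N) : Prop :=
  exists z : 'rV[int]_n, x = map_mx (fun k : int => k%:~R) z *m B.

Definition is_sublattice_basis {k n N : nat} (C : 'M[R]_(k, N)) (B : 'M[R]_(n, N)) : Prop :=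
  row_free C /\ forall i : 'I_k, in_lattice B (row i C).

Definition lat_vol {n N : nat} (B : 'M[R]_(n, N)) : R :=
  Num.sqrt (\det (B *m B^T)).

Definition lat_deg {n N : nat} (B : 'M[R]_(n, N)) : R := - ln (lat_vol B).

Definition lat_slope {n N : nat} (B : 'M[R]_(n, N)) : R := lat_deg B / n%:R.

Definition semistable {n N : nat} (B : 'M[R]_(n, N)) : Prop :=
  row_free B /\
  forall (k : nat) (C : 'M[R]_(k, N)), (0 < k)%N -> is_sublattice_basis C B ->
    lat_slope C <= lat_slope B.

(* Tensor product lattice: basis b_i (x) c_j, realized in R^(N1*N2) via the
   Kronecker product, whose standard inner product satisfies
   (v (x) w, v' (x) w') = (v,v')(w,w'). *)
Definition lat_tensor {n1 N1 n2 N2 : nat} (B1 : 'M[R]_(n1, N1)) (B2 : 'M[R]_(n2, N2))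
  : 'M[R]_(n1 * n2, N1 * N2) := B1 *t B2.

End Lattices.

(* Main.v *)
Require Import Defs.
From HB Require Import structures.
From mathcomp Require Import all_boot all_order all_algebra.
From mathcomp Require Import all_classical all_reals all_analysis.
From mathcomp Require Import mxtens.
From mathcomp Require Import perm zify ring lra.
Import Order.TTheory GRing.Theory Num.Theory.
Local Open Scope ring_scope.
Set Implicit Arguments. Unset Strict Implicit. Unset Printing Implicit Defensive.

(** After scaling, all sublattices of L and M have covolume at least 1, and the claim
  is that a sublattice S of L (x) M of rank k <= 3 has covolume at least 1.

  A nonzero vector of L (x) M of tensor rank r is a sum of products u_i (x) w_i,
  i <= r, of independent vectors of L and of M (Smith normal form), and AM-GM then
  gives squared norm at least r. So a vector of squared norm < 2 is a pure tensor.

  If S is a counterexample of least rank, with a basis of least total squared norm,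
  then its longest basis vector v satisfies |v|^2 <= |v*|^2 + (k-1)/4 |v|^2, where v*
  is the part of v orthogonal to the other basis vectors; these span a lattice of
  covolume at least 1, so 1 > vol(S)^2 >= |v*|^2 >= |v|^2 / 2. Hence the basis consists of
  pure tensors e_i (x) f_i, and its Gram matrix is the Hadamard product of those of
  (e_i) and (f_i). If one of these families is independent, Oppenheim's inequality
  concludes; otherwise k = 3, both families span planes, and the determinant is
  computed explicitly. *)

(** * Linear independence of rows *)

Lemma row_free_kerP (F : fieldType) m n (A : 'M[F]_(m, n)) :
  (forall x : 'rV_m, x *m A = 0 -> x = 0) <-> row_free A.
Proof.
split=> [A_inj | A_free x /eqP]; last by rewrite mulmx_free_eq0 // => /eqP.
rewrite -kermx_eq0; apply/eqP/row_matrixP => i; rewrite row0.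
by apply: A_inj; apply/sub_kermxP/row_sub.
Qed.

Lemma row_free_mull (F : fieldType) p m n (A : 'M[F]_(p, m)) (B : 'M[F]_(m, n)) :
  row_free (A *m B) -> row_free A.
Proof.
move=> /row_free_kerP AB; apply/row_free_kerP => x xA0.
by apply: AB; rewrite mulmxA xA0 mul0mx.
Qed.

Lemma row_free_mul (F : fieldType) p m n (A : 'M[F]_(p, m)) (B : 'M[F]_(m, n)) :
  row_free A -> row_free B -> row_free (A *m B).
Proof.
move=> /row_free_kerP hA /row_free_kerP hB; apply/row_free_kerP => x.
by rewrite mulmxA => /hB /hA.
Qed.

Lemma row_free_dsub (F : fieldType) m1 m2 n (u : 'M[F]_(m1, n)) (A : 'M[F]_(m2, n)) :
  row_free (col_mx u A) -> row_free A.
Proof.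
move=> /row_free_kerP h; apply/row_free_kerP => x xA0.
have := h (row_mx 0 x); rewrite mul_row_col mul0mx add0r => /(_ xA0) /eqP.
by rewrite -row_mx0 => /eqP/eq_row_mx[].
Qed.

Lemma row_free_row_neq0 (F : fieldType) m n (A : 'M[F]_(m, n)) i :
  row_free A -> row i A != 0.
Proof.
move=> hA; rewrite rowE mulmx_free_eq0 //; apply/eqP => /matrixP /(_ 0 i).
by rewrite !mxE !eqxx => /eqP; rewrite oner_eq0.
Qed.

(** * Gram determinants *)

Section Gram.
Variable R : realFieldType.

Definition dot n (x y : 'rV[R]_n) : R := (x *m y^T) 0 0.

Definition gram m n (A : 'M[R]_(m, n)) : 'M[R]_m := A *m A^T.

Section Dot.
Variable n : nat.
Implicit Types x y z : 'rV[R]_n.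

Lemma dotE x y : dot x y = \sum_i x 0 i * y 0 i.
Proof. by rewrite /dot mxE; apply: eq_bigr => i _; rewrite mxE. Qed.

Lemma dotC x y : dot x y = dot y x.
Proof. by rewrite !dotE; apply: eq_bigr => i _; rewrite mulrC. Qed.

Lemma dotDl x y z : dot (x + y) z = dot x z + dot y z.
Proof. by rewrite /dot mulmxDl mxE. Qed.

Lemma dotZl a x y : dot (a *: x) y = a * dot x y.
Proof. by rewrite /dot -scalemxAl mxE. Qed.

Lemma dotDr x y z : dot x (y + z) = dot x y + dot x z.
Proof. by rewrite dotC dotDl !(dotC x). Qed.

Lemma dotZr a x y : dot x (a *: y) = a * dot x y.
Proof. by rewrite dotC dotZl dotC. Qed.

Lemma dot0l x : dot 0 x = 0.
Proof. by rewrite /dot mul0mx mxE. Qed.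

Lemma dot_ge0 x : 0 <= dot x x.
Proof. by rewrite dotE sumr_ge0 // => i _; rewrite -expr2 sqr_ge0. Qed.

Lemma dot_eq0 x : (dot x x == 0) = (x == 0).
Proof.
apply/eqP/eqP => [|->]; last by rewrite dot0l.
rewrite dotE => /psumr_eq0P => h; apply/rowP => i; rewrite mxE.
by apply/eqP; rewrite -sqrf_eq0 expr2 h // => j _; rewrite -expr2 sqr_ge0.
Qed.

Lemma dot_gt0 x : (0 < dot x x) = (x != 0).
Proof. by rewrite lt_def dot_eq0 dot_ge0 andbT. Qed.

Lemma dot_suml (I : finType) (P : pred I) (F : I -> 'rV[R]_n) y :
  dot (\sum_(i | P i) F i) y = \sum_(i | P i) dot (F i) y.
Proof.
by apply: (big_morph (fun x => dot x y)) => [u v|]; rewrite ?dotDl ?dot0l.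
Qed.

Lemma CauchySchwarz_dot x y : dot x y ^+ 2 <= dot x x * dot y y.
Proof.
have [->|y0] := eqVneq y 0; first by rewrite dotC !dot0l expr0n mulr0.
have yy : 0 < dot y y by rewrite dot_gt0.
have := dot_ge0 (dot y y *: x - dot x y *: y).
rewrite -scaleNr !(dotDl, dotDr, dotZl, dotZr) (dotC y x) => h.
rewrite -subr_ge0 -(pmulr_rge0 _ yy); move: h; congr (0 <= _); ring.
Qed.

End Dot.
Lemma dot_mulmx m n (A : 'M[R]_(m, n)) x y : dot (x *m A) y = dot x (y *m A^T).
Proof. by rewrite /dot trmx_mul trmxK mulmxA. Qed.

Lemma gramE m n (A : 'M[R]_(m, n)) i j : gram A i j = dot (row i A) (row j A).
Proof. by rewrite dotE mxE; apply: eq_bigr => l _; rewrite !mxE. Qed.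

Lemma det_gram1 n (x : 'rV[R]_n) : \det (gram x) = dot x x.
Proof. by rewrite [gram x]mx11_scalar det_scalar1. Qed.

Lemma det_gram_mul m n (T : 'M[R]_m) (A : 'M[R]_(m, n)) :
  \det (gram (T *m A)) = \det T ^+ 2 * \det (gram A).
Proof.
by rewrite /gram trmx_mul mulmxA -(mulmxA T) !det_mulmx det_tr mulrAC.
Qed.

Lemma gram_unit m n (A : 'M[R]_(m, n)) : row_free A -> gram A \in unitmx.
Proof.
move=> /row_free_kerP hA; rewrite -row_free_unit; apply/row_free_kerP => x h.
apply/hA/eqP; rewrite -dot_eq0 dot_mulmx -mulmxA.
by rewrite -[A *m A^T]/(gram A) h dotC dot0l.
Qed.

Lemma ortho_decomp m n (A : 'M[R]_(m, n)) (x : 'rV[R]_n) : row_free A ->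
  exists c y, x = c *m A + y /\ y *m A^T = 0.
Proof.
(* [c] solves the normal equations, so [c *m A] is the orthogonal projection of [x] onto the row
   space. *)
move=> /gram_unit hA; pose c := x *m A^T *m invmx (gram A).
exists c, (x - c *m A); split; first by rewrite addrC subrK.
by rewrite mulmxBl -(mulmxA c) -[A *m A^T]/(gram A) mulmxKV // subrr.
Qed.

Lemma det_gram_add m n (A : 'M[R]_(m, n)) (x : 'rV_n) c :
  \det (gram (col_mx (x + c *m A) A)) = \det (gram (col_mx x A)).
Proof.
have -> : col_mx (x + c *m A) A = block_mx 1%:M c 0 1%:M *m col_mx x A.
  by rewrite mul_block_col !mul1mx mul0mx add0r.
by rewrite det_gram_mul det_ublock !det1 mulr1 expr1n mul1r.
Qed.

Lemma row_free_add m n (A : 'M[R]_(m, n)) (x : 'rV_n) c :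
  row_free (col_mx x A) -> row_free (col_mx (x + c *m A) A).
Proof.
have -> : col_mx (x + c *m A) A = block_mx 1%:M c 0 1%:M *m col_mx x A.
  by rewrite mul_block_col !mul1mx mul0mx add0r.
apply: row_free_mul; rewrite row_free_unit unitmxE det_ublock !det1 mulr1.
exact: unitr1.
Qed.

Lemma det_gram_ortho m n (A : 'M[R]_(m, n)) (x : 'rV_n) : x *m A^T = 0 ->
  \det (gram (col_mx x A)) = dot x x * \det (gram A).
Proof.
move=> xA; rewrite /gram tr_col_mx mul_col_row xA.
rewrite det_lblock; congr (_ * _).
by rewrite [_ *m _]mx11_scalar det_scalar1.
Qed.

Lemma det_gram_gt0 m n (A : 'M[R]_(m, n)) : row_free A -> 0 < \det (gram A).
Proof.
elim: m A => [|m IH] A; first by rewrite det_mx00.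
rewrite -[m.+1]/(1 + m)%N in A *; rewrite -[A]vsubmxK.
move: (usubmx A) (dsubmx A) => x {}A xA; have hA := row_free_dsub xA.
have [c [y [xE yA]]] := ortho_decomp x hA.
rewrite xE addrC det_gram_add det_gram_ortho // mulr_gt0 ?IH // dot_gt0.
(* If [y = 0], then [x = c *m A], and [(1, -c)] is a linear relation between the rows. *)
apply/eqP => y0; move/row_free_kerP: xA => /(_ (row_mx 1 (- c))).
rewrite mul_row_col mul1mx mulNmx xE y0 addr0 subrr => /(_ erefl)/eqP.
rewrite -row_mx0 => /eqP/eq_row_mx[] /matrixP/(_ 0 0).
by rewrite !mxE => /eqP; rewrite oner_eq0.
Qed.

Lemma row_free_det m n (A : 'M[R]_(m, n)) : row_free A = (\det (gram A) != 0).
Proof.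
apply/idP/idP => [/det_gram_gt0/lt0r_neq0 //|]; rewrite -unitfE -unitmxE.
by rewrite -row_free_unit; apply: row_free_mull.
Qed.

(** The quotient of the two Gram determinants is the squared distance from [x] to the row space of
    [A]; Cauchy-Schwarz against a vector [w] orthogonal to that space bounds it from below. *)
Lemma det_gram_ge_ortho m n (A : 'M[R]_(m, n)) (x w : 'rV_n) :
  row_free A -> w *m A^T = 0 ->
  \det (gram A) * dot x w ^+ 2 <= \det (gram (col_mx x A)) * dot w w.
Proof.
move=> hA wA; have [c [y [-> yA]]] := ortho_decomp x hA.
rewrite addrC det_gram_add det_gram_ortho // dotDl dot_mulmx wA.
rewrite [dot c 0]dotC dot0l addr0 mulrAC [leRHS]mulrC.
by rewrite ler_wpM2l ?CauchySchwarz_dot // ltW // det_gram_gt0.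
Qed.

Lemma det_gram_col_le m n (A : 'M[R]_(m, n)) (x : 'rV_n) : row_free A ->
  \det (gram (col_mx x A)) <= dot x x * \det (gram A).
Proof.
move=> hA; have [c [y [-> yA]]] := ortho_decomp x hA.
rewrite addrC det_gram_add det_gram_ortho //.
rewrite ler_wpM2r ?(ltW (det_gram_gt0 hA)) //.
rewrite dotDl !dotDr ![dot _ (c *m A)]dotC !dot_mulmx yA ![dot c 0]dotC dot0l.
by rewrite addr0 add0r lerDl -dot_mulmx dot_ge0.
Qed.

End Gram.

(* Each coefficient of [c] is rounded up or down in turn; of the two choices
   one does not increase the squared norm by more than [1/4] of that of the row,
   since the average weighted by the fractional part does not. *)
Lemma lattice_rounding (R : archiRealFieldType) m n (A : 'M[R]_(m, n))
    (y : 'rV_n) (c : 'rV_m) :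
  exists z : 'rV[int]_m,
    dot (y + (c + map_mx intr z) *m A) (y + (c + map_mx intr z) *m A) <=
    dot y y + 4^-1 * \sum_i dot (row i A) (row i A).
Proof.
elim: m A y c => [|m IH] A y c.
  exists 0; rewrite big_ord0 mulr0 addr0.
  by rewrite [_ *m A](_ : _ = 0) ?addr0 ?lexx //; apply/rowP => i; rewrite !mxE big_ord0.
rewrite -[m.+1]/(1 + m)%N in A c *; rewrite -[A]vsubmxK -[c]hsubmxK.
move: (usubmx A) (dsubmx A) (lsubmx c) (rsubmx c) => u {}A c0 {}c.
pose k := Num.floor (c0 0 0).
have k1 : k%:~R <= c0 0 0 by exact: floor_le.
have k2 : c0 0 0 < k%:~R + 1 by have := floorD1_gt (c0 0 0); rewrite intrD.
pose t := c0 0 0 - k%:~R.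
have [e he] : exists e : int,
    dot (y + (c0 0 0 + e%:~R) *: u) (y + (c0 0 0 + e%:~R) *: u) <=
    dot y y + 4^-1 * dot u u.
  have uu := dot_ge0 u.
  have F s : dot (y + s *: u) (y + s *: u) =
             dot y y + 2 * s * dot y u + s ^+ 2 * dot u u.
    by rewrite !(dotDl, dotDr, dotZl, dotZr) (dotC u y); ring.
  (* Weighting the coefficients [t] and [t - 1] by [1 - t] and [t] cancels the linear term of [F]
     and leaves [t * (1 - t)], at most 1/4. *)
  have avg : t * (1 - t) * dot u u <= 4^-1 * dot u u.
    by rewrite ler_wpM2r //; have := sqr_ge0 (t - 2^-1); rewrite expr2; nra.
  have [hp|hp] := leP (dot (y + t *: u) (y + t *: u)) (dot y y + 4^-1 * dot u u).
    by exists (- k); rewrite mulrNz.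
  exists (- k - 1); rewrite mulrzBr mulrNz addrA -/t.
  move: hp; rewrite !F => hp.
  have [tge0 tlt1] : 0 <= t /\ t < 1 by rewrite /t; split; lra.
  have [t0|t0] := eqVneq t 0; first by rewrite t0 in hp; lra.
  have {}t0 : 0 < t by rewrite lt_def t0.
  rewrite -(ler_pM2l t0).
  move: (dot y y) (dot y u) (dot u u) uu avg hp F => a b d *; nra.
have [z hz] := IH A (y + (c0 0 0 + e%:~R) *: u) c.
exists (row_mx (const_mx e) z).
have -> : y + (row_mx c0 c + map_mx intr (row_mx (const_mx e) z)) *m col_mx u A =
   y + (c0 0 0 + e%:~R) *: u + (c + map_mx intr z) *m A.
  rewrite map_row_mx add_row_mx mul_row_col addrA; congr (_ + _ + _).
  by rewrite [c0 + _]mx11_scalar mul_scalar_mx !mxE.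
apply: le_trans hz _; rewrite big_split_ord big_ord1 /= mulrDr addrA.
rewrite [X in _ <= _ + _ * X](eq_bigr (fun i => dot (row i A) (row i A))).
  by rewrite rowKu row_id lerD2r.
by move=> i _; rewrite rowKd.
Qed.

(** * Products of vectors *)

Section TensorVectors.
Variables (R : realFieldType) (N1 N2 : nat).

Definition tensv (u : 'rV[R]_N1) (v : 'rV[R]_N2) : 'rV[R]_(N1 * N2) :=
  \row_l (u 0 (mxtens_unindex l).1 * v 0 (mxtens_unindex l).2).

Lemma tensvDl u u' v : tensv (u + u') v = tensv u v + tensv u' v.
Proof. by apply/rowP => i; rewrite !mxE mulrDl. Qed.

Lemma tensvDr u v v' : tensv u (v + v') = tensv u v + tensv u v'.
Proof. by apply/rowP => i; rewrite !mxE mulrDr. Qed.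

Lemma tensvZl a u v : tensv (a *: u) v = a *: tensv u v.
Proof. by apply/rowP => i; rewrite !mxE mulrA. Qed.

Lemma tensvZr a u v : tensv u (a *: v) = a *: tensv u v.
Proof. by apply/rowP => i; rewrite !mxE mulrCA. Qed.

Lemma tens0v v : tensv 0 v = 0.
Proof. by apply/rowP => i; rewrite !mxE mul0r. Qed.

Lemma tensv0 u : tensv u 0 = 0.
Proof. by apply/rowP => i; rewrite !mxE mulr0. Qed.

Lemma tensv_sumr (I : finType) (F : I -> 'rV[R]_N2) u :
  tensv u (\sum_i F i) = \sum_i tensv u (F i).
Proof. by apply: (big_morph (tensv u)) => [v w|]; rewrite ?tensvDr ?tensv0. Qed.

Lemma dot_tensv u v u' v' :
  dot (tensv u v) (tensv u' v') = dot u u' * dot v v'.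
Proof.
rewrite !dotE mulr_sum; apply: eq_bigr => i _; rewrite !mxE; ring.
Qed.

(** The row-wise Khatri-Rao product. *)
Definition tens_rows k (E : 'M[R]_(k, N1)) (F : 'M[R]_(k, N2)) :=
  \matrix_(i < k) tensv (row i E) (row i F).

Lemma tens_rows_col k e (E : 'M[R]_(k, N1)) f (F : 'M[R]_(k, N2)) :
  tens_rows (col_mx e E : 'M[R]_(1 + k, _)) (col_mx f F) =
  col_mx (tensv e f) (tens_rows E F).
Proof.
apply/row_matrixP => i; rewrite rowK.
case: (split_ordP i) => j ->; rewrite ?(rowKu, rowKd) ?rowK //.
by rewrite [j]ord1 !row_id.
Qed.

Lemma gram_tens_rows k (E : 'M[R]_(k, N1)) (F : 'M[R]_(k, N2)) i j :
  gram (tens_rows E F) i j = gram E i j * gram F i j.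
Proof. by rewrite !gramE !rowK dot_tensv. Qed.

(* Gram-Schmidt on the [f_i]: the part of [e_i (x) f_i] orthogonal to the other
   products is at least as long as [e_i (x) f_i^*]. *)
Lemma Oppenheim k (E : 'M[R]_(k, N1)) (F : 'M[R]_(k, N2)) :
  row_free F -> row_free (tens_rows E F) ->
  \det (gram F) * \prod_i dot (row i E) (row i E) <= \det (gram (tens_rows E F)).
Proof.
elim: k E F => [|k IH] E F; first by rewrite !det_mx00 big_ord0 mulr1.
rewrite -[k.+1]/(1 + k)%N in E F *; rewrite -[E]vsubmxK -[F]vsubmxK.
move: (usubmx E) (dsubmx E) (usubmx F) (dsubmx F) => e {}E f {}F fF.
rewrite tens_rows_col => efEF.
have hF := row_free_dsub fF; have hEF := row_free_dsub efEF.
have [c [g [fE gF]]] := ortho_decomp f hF.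
have fg : dot f g = dot g g.
  by rewrite fE dotDl dotC -[dot g _]dotC dot_mulmx gF dotC dot0l add0r.
have wEF : tensv e g *m (tens_rows E F)^T = 0.
  apply/rowP => i; rewrite !mxE.
  transitivity (dot (tensv e g) (tensv (row i E) (row i F))).
    by rewrite dotE; apply: eq_bigr => l _; rewrite !mxE.
  rewrite dot_tensv; have /rowP/(_ i) := gF; rewrite !mxE => h.
  rewrite [dot g _](_ : _ = 0) ?mulr0 // -[RHS]h dotE.
  by apply: eq_bigr => l _; rewrite !mxE.
have := det_gram_ge_ortho (tensv e f) hEF wEF; rewrite !dot_tensv fg.
have -> : \det (gram (col_mx f F)) = dot g g * \det (gram F).
  by rewrite {1}fE addrC det_gram_add det_gram_ortho.
have e0 : 0 < dot e e.
  rewrite dot_gt0; apply/eqP => e0; have := row_free_row_neq0 (lshift k 0) efEF.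
  by rewrite rowKu row_id e0 tens0v eqxx.
have g0 : 0 < dot g g.
  have := det_gram_gt0 fF; rewrite {1}fE addrC det_gram_add det_gram_ortho //.
  by rewrite pmulr_lgt0 // det_gram_gt0.
(* The test vector [w = e (x) g] satisfies [<e (x) f, w> = <w, w> = p], so one factor [p]
   cancels. *)
rewrite expr2; set p := dot e e * dot g g.
rewrite mulrA (ler_pM2r (mulr_gt0 e0 g0 : 0 < p)); apply: le_trans.
rewrite big_split_ord big_ord1 /= rowKu row_id.
rewrite (eq_bigr (fun i => dot (row i E) (row i E))); last first.
  by move=> i _; rewrite rowKd.
have h := IH E F hF hEF; rewrite -(ler_pM2r (mulr_gt0 e0 g0 : 0 < p)) in h.
by apply: le_trans h; rewrite le_eqVlt; apply/orP; left; apply/eqP; rewrite /p; ring.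
Qed.

End TensorVectors.

Lemma gram_tens_rowsC (R : realFieldType) N1 N2 k
  (E : 'M[R]_(k, N1)) (F : 'M[R]_(k, N2)) :
  gram (tens_rows E F) = gram (tens_rows F E).
Proof. by apply/matrixP => i j; rewrite !gram_tens_rows mulrC. Qed.

(* By induction on the tensor rank: replacing [w_r] by its component orthogonal to the
   other [w_i] changes the other [u_i] by multiples of [u_r], and the two
   determinants split up by Fischer's inequality; [1 + ln t <= t] does the rest. *)
Lemma norm_sum_tensv (R : realType) N1 N2 k (U : 'M[R]_(k, N1)) (W : 'M[R]_(k, N2)) :
  row_free U -> row_free W ->
  k%:R + ln (\det (gram U)) + ln (\det (gram W)) <=
  dot (\sum_i tensv (row i U) (row i W)) (\sum_i tensv (row i U) (row i W)).
Proof.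
elim: k U W => [|k IH] U W.
  by rewrite !det_mx00 ln1 !addr0 big_ord0 dot0l.
rewrite -[k.+1]/(1 + k)%N in U W *; rewrite -[U]vsubmxK -[W]vsubmxK.
move: (usubmx U) (dsubmx U) (usubmx W) (dsubmx W) => u {}U w {}W uU wW.
have hU := row_free_dsub uU; have hW := row_free_dsub wW.
have [c [g [wE gW]]] := ortho_decomp w hW.
pose U' := U + c^T *m u.
have dU' : \det (gram (col_mx u U)) = \det (gram (col_mx u U')).
  have -> : col_mx u U' = block_mx 1%:M 0 c^T 1%:M *m col_mx u U.
    by rewrite mul_block_col !mul1mx mul0mx addr0 addrC.
  by rewrite det_gram_mul det_lblock !det1 mulr1 expr1n mul1r.
have uU' : row_free (col_mx u U').
  by rewrite row_free_det -dU' -row_free_det.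
have hU' := row_free_dsub uU'.
have g0 : 0 < dot g g.
  have := det_gram_gt0 wW; rewrite {1}wE addrC det_gram_add det_gram_ortho //.
  by rewrite pmulr_lgt0 // det_gram_gt0.
have u0 : 0 < dot u u.
  rewrite dot_gt0; have := row_free_row_neq0 (lshift k 0) uU.
  by rewrite rowKu row_id.
have -> : \det (gram (col_mx w W)) = dot g g * \det (gram W).
  by rewrite {1}wE addrC det_gram_add det_gram_ortho.
have -> : \sum_i tensv (row i (col_mx u U)) (row i (col_mx w W)) =
          tensv u g + \sum_i tensv (row i U') (row i W).
  rewrite big_split_ord big_ord1 /= !rowKu !row_id wE tensvDr addrC addrA [RHS]addrC.
  congr (_ + _); rewrite -[c in c *m W]mul1mx mulmx_sum_row tensv_sumr -big_split.
  apply: eq_bigr => i _ /=; rewrite !rowKd tensvZr -tensvZl -tensvDl.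
  congr (tensv _ _); apply/rowP => j; rewrite !mxE big_ord1 !mxE.
  by rewrite big_ord1 !mxE eqxx mul1r.
have ug : dot (tensv u g) (\sum_i tensv (row i U') (row i W)) = 0.
  rewrite dotC dot_suml big1 // => i _; rewrite dot_tensv.
  have /rowP/(_ i) := gW; rewrite !mxE => h.
  rewrite [dot _ g](_ : _ = 0) ?mulr0 // dotC -[RHS]h dotE.
  by apply: eq_bigr => l _; rewrite !mxE.
rewrite dotDl !dotDr [dot (\sum_i _) (tensv u g)]dotC ug addr0 add0r dot_tensv.
have dU0 := det_gram_gt0 hU'; have dW0 := det_gram_gt0 hW.
have H1 : ln (\det (gram (col_mx u U))) <= ln (dot u u) + ln (\det (gram U')).
  rewrite -lnM ?posrE // dU' ler_ln ?posrE ?det_gram_gt0 ?mulr_gt0 //.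
  exact: det_gram_col_le.
have H2 : 1 + (ln (dot u u) + ln (dot g g)) <= dot u u * dot g g.
  rewrite -lnM ?posrE //; have ug0 := mulr_gt0 u0 g0.
  by have := expR_ge1Dx (ln (dot u u * dot g g)); rewrite lnK ?posrE.
have := IH U' W hU' hW; rewrite lnM ?posrE // natrD.
by move: H1 H2; lra.
Qed.

(** * Short vectors of a tensor product *)

Lemma row_free_rowsub (F : fieldType) m n p (f : 'I_p -> 'I_m) (A : 'M[F]_(m, n)) :
  injective f -> row_free A -> row_free (rowsub f A).
Proof.
move=> f_inj hA; rewrite -[A]mul1mx -mul_rowsub_mx row_free_mul //.
apply/row_freeP; exists (rowsub f 1%:M)^T; apply/matrixP => i j.
rewrite !mxE (bigD1 (f j)) //= big1 ?addr0; last first.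
  by move=> l /negPf lj; rewrite !mxE (eq_sym (f j)) lj mulr0.
by rewrite !mxE eqxx mulr1 (inj_eq f_inj).
Qed.

Section Lattices.
Variable R : realType.

Lemma in_lattice_mul k n N (Z : 'M[int]_(k, n)) (B : 'M[R]_(n, N)) i :
  in_lattice B (row i (map_mx intr Z *m B)).
Proof. by exists (row i Z); rewrite row_mul map_row. Qed.

Lemma row_free_intr_unit n (A : 'M[int]_n) :
  A \in unitmx -> row_free (map_mx intr A : 'M[R]_n).
Proof.
by rewrite row_free_unit !unitmxE det_map_mx; apply: rmorph_unit.
Qed.

(** Truncate the Smith normal form [L D T] to its nonzero part: [P] consists of the first [r]
    columns of [L], scaled by the invariant factors, and [Q] of the first [r] rows of [T]. *)
Lemma int_rank_factorization m n (M : 'M[int]_(m, n)) :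
  exists r (P : 'M[int]_(r, m)) (Q : 'M[int]_(r, n)),
    [/\ M = P^T *m Q, row_free (map_mx intr P : 'M[R]_(r, m)) &
        row_free (map_mx intr Q : 'M[R]_(r, n))].
Proof.
have [L uL [T uT [d d_dvd ->]]] := int_Smith_normal_form M.
(* [s] is the position of the first zero of [d], or its length if there is none; later entries
   vanish because each divides the next. The bounds [m] and [n] stop where the diagonal ends. *)
pose s := find (pred1 0) d; pose r := minn s (minn m n).
have d_neq0 i : (i < r)%N -> d`_i != 0.
  by rewrite /r leq_min => /andP[ilts _]; have /= -> := before_find 0 ilts.
have d_eq0 i : (s <= i)%N -> d`_i = 0.
  move=> si; have [di|di] := ltnP i (size d); last exact: nth_default.
  have hs : has (pred1 0) d by rewrite has_find; apply: leq_ltn_trans di.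
  have /eqP ds := nth_find 0 hs.
  have := sorted_leq_nth dvdz_trans dvdzz 0 d_dvd.
  move=> /(_ s i); rewrite !inE -/s ds => h.
  by apply/eqP; rewrite -dvd0z h // -has_find.
have rm : (r <= m)%N by rewrite /r minnCA geq_minl.
have rn : (r <= n)%N by rewrite /r minnA geq_minr.
pose D := diag_mx (\row_(i < r) d`_i).
exists r, (D *m rowsub (widen_ord rm) L^T), (rowsub (widen_ord rn) T).
have w_inj p (rp : (r <= p)%N) : injective (widen_ord rp).
  by move=> i j /(congr1 val) /= ij; apply: val_inj.
split.
- rewrite /D mul_diag_mx; apply/matrixP => i j; rewrite -mulmxA !mxE.
  (* [insub] reads [l] as a row index of [T]; its default 0 is never reached, because
     [l < r <= n]. *)
  rewrite (eq_bigr (fun l : 'I_m => if (l < r)%N then L i l * (d`_l *+ (l < n)%N) *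
      (if insub (val l) is Some l' then T l' j else 0) else 0)); last first.
    move=> l _; rewrite !mxE; case: ltnP => lr.
      have ln : (l < n)%N by apply: leq_trans lr rn.
      rewrite (bigD1 (Ordinal ln)) //= big1 ?addr0; last first.
        by move=> j' /negPf; rewrite !mxE -val_eqE /= eq_sym => ->; rewrite mul0r.
      by rewrite !mxE eqxx mulr1n ln mulr1n insubT /= mulrA.
    rewrite big1 ?mulr0 // => j' _; rewrite !mxE.
    case: eqP => [lj|]; last by rewrite mul0r.
    rewrite d_eq0 ?mul0r //; move: lr; rewrite /r !geq_min => /or3P[//| |].
      by rewrite leqNgt ltn_ord.
    by rewrite lj leqNgt ltn_ord.
  rewrite -big_mkcond (big_ord_narrow rm) /=; apply: eq_bigr => l _.
  have ln : (l < n)%N by apply: leq_trans rn.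
  rewrite !mxE ln mulr1n insubT /= [d`_l * _]mulrC.
  by congr (_ * T _ _); apply: val_inj.
- rewrite map_mxM row_free_mul // ?map_mxsub ?map_trmx.
    rewrite row_free_unit unitmxE det_map_mx det_diag rmorph_prod unitfE.
    by apply/prodf_neq0 => i _; rewrite mxE intr_eq0 d_neq0.
  apply: row_free_rowsub; first exact: w_inj.
  by apply: row_free_intr_unit; rewrite unitmx_tr.
- rewrite map_mxsub; apply: row_free_rowsub; first exact: w_inj.
  exact: row_free_intr_unit.
Qed.

(** All slopes are at most 0, phrased with squared covolumes; rank 0 is harmless, the empty
    determinant being 1. *)
Definition covol_ge1 n N (B : 'M[R]_(n, N)) :=
  row_free B /\
  forall k (C : 'M[R]_(k, N)), is_sublattice_basis C B -> 1 <= \det (gram C).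

Lemma is_sublattice_basis_mul k n N (Z : 'M[int]_(k, n)) (B : 'M[R]_(n, N)) :
  row_free (map_mx intr Z : 'M[R]__) -> row_free B ->
  is_sublattice_basis (map_mx intr Z *m B) B.
Proof.
by move=> hZ hB; split=> [|i]; [apply: row_free_mul | apply: in_lattice_mul].
Qed.

(** Reshaping [x] and its coefficient vector into matrices lets a factorization of [Z] split [x]
    into products. *)
Lemma in_lattice_tensorP n1 N1 n2 N2 (B1 : 'M[R]_(n1, N1)) (B2 : 'M[R]_(n2, N2)) x :
  in_lattice (lat_tensor B1 B2) x -> exists Z : 'M[int]_(n1, n2),
  forall s t, x 0 (mxtens_index (s, t)) = (B1^T *m map_mx intr Z *m B2) s t.
Proof.
case=> z ->; exists (\matrix_(a, b) z 0 (mxtens_index (a, b))) => s t.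
rewrite mxE [RHS]mxE; under [RHS]eq_bigr do rewrite mxE big_distrl /=.
rewrite exchange_big pair_big /= (reindex (@mxtens_index n1 n2)) /=; last first.
  by exists (@mxtens_unindex n1 n2) => i _; rewrite (mxtens_indexK, mxtens_unindexK).
apply: eq_bigr => -[a b] _; rewrite tensmxE !mxE /=; ring.
Qed.

(** A rank factorization of the coefficient matrix writes [x] with [r] products of rows of [U] and
    [W]. These are sublattice bases, so both logarithms in [norm_sum_tensv] are nonnegative and the
    squared norm is at least [r]. *)
Lemma tensor_lattice_vector n1 N1 n2 N2
    (B1 : 'M[R]_(n1, N1)) (B2 : 'M[R]_(n2, N2)) x :
  covol_ge1 B1 -> covol_ge1 B2 -> in_lattice (lat_tensor B1 B2) x -> x != 0 ->
  (exists e f, [/\ in_lattice B1 e, in_lattice B2 f & x = tensv e f]) \/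
  2 <= dot x x.
Proof.
move=> [fB1 hB1] [fB2 hB2] /in_lattice_tensorP[Z xE] x0.
have [r [P [Q [ZE fP fQ]]]] := int_rank_factorization Z.
pose U := map_mx intr P *m B1; pose W := map_mx intr Q *m B2.
have hU : is_sublattice_basis U B1 by apply: is_sublattice_basis_mul.
have hW : is_sublattice_basis W B2 by apply: is_sublattice_basis_mul.
have {}xE : x = \sum_i tensv (row i U) (row i W).
  apply/rowP => l; case: (mxtens_indexP l) => s t; rewrite xE ZE map_mxM -map_trmx.
  rewrite mulmxA -trmx_mul -mulmxA -/U -/W summxE mxE.
  by apply: eq_bigr => i _; rewrite !mxE mxtens_indexK /= ?mxE.
have [r1|r2] := leqP r 1; [left|right].
  case: r r1 => [|[|//]] _ in P Q ZE fP fQ U W hU hW xE *.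
    by rewrite xE big_ord0 eqxx in x0.
  exists (row 0 U), (row 0 W); split; [exact: hU.2|exact: hW.2|].
  by rewrite xE big_ord1.
have lnU := ln_ge0 (hB1 _ _ hU); have lnW := ln_ge0 (hB2 _ _ hW).
have := norm_sum_tensv hU.1 hW.1; rewrite -xE; apply: le_trans.
have : (2 : R) <= r%:R by rewrite ler_nat.
lra.
Qed.

End Lattices.

(** * Lattices spanned by pure tensors *)

Lemma det_mx22 (R : comNzRingType) (A : 'M[R]_2) :
  \det A = A 0 0 * A 1 1 - A 0 1 * A 1 0.
Proof.
rewrite (expand_det_row _ 0) !big_ord_recl big_ord0 addr0 /cofactor !det_mx11 !mxE.
rewrite /= expr0 expr1 mul1r mulN1r mulrN.
by congr (A _ _ * A _ _ - A _ _ * A _ _); apply: val_inj.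
Qed.

Lemma det_mx33 (R : comNzRingType) (A : 'M[R]_3) :
  \det A = A 0 0 * (A 1 1 * A 2%:R 2%:R - A 1 2%:R * A 2%:R 1)
         - A 0 1 * (A 1 0 * A 2%:R 2%:R - A 1 2%:R * A 2%:R 0)
         + A 0 2%:R * (A 1 0 * A 2%:R 1 - A 1 1 * A 2%:R 0).
Proof.
rewrite (expand_det_row _ 0) !big_ord_recl big_ord0 addr0 /cofactor !det_mx22 !mxE.
rewrite /= /bump /= !add1n !addn0 expr0 expr1 sqrrN expr1n !mul1r mulN1r mulrN addrA.
do ![congr (_ + _) | congr (- _) | congr (_ * _) | congr (A _ _)]; exact: val_inj.
Qed.

Lemma AGM2_le (R : realFieldType) (x y t : R) :
  0 <= x -> 0 <= y -> 0 <= t -> t ^+ 2 <= x * y -> 2 * t <= x + y.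
Proof.
move=> x0 y0 t0 txy; rewrite -(@ler_pXn2r _ 2) ?nnegrE ?mulr_ge0 ?addr_ge0 //.
by have := sqr_ge0 (x - y); rewrite sqrrB sqrrD exprMn; lra.
Qed.

(* [Delta * Gamma * Q] is the Gram determinant of [e1 (x) f1], [e2 (x) f2] and
   [(p e1 + q e2) (x) (r f1 + s f2)], where [a, c, a'] and [b, d, b'] are the entries
   of the Gram matrices of [(e1, e2)] and [(f1, f2)]. *)
Lemma planar_bound (R : realFieldType) (a a' b b' c d p q r s : R) :
  let Delta := a * a' - c ^+ 2 in let Gamma := b * b' - d ^+ 2 in
  1 <= a -> 1 <= a' -> 1 <= b -> 1 <= b' -> 1 <= Delta -> 1 <= Gamma ->
  (p != 0 -> 1 <= p ^+ 2 * Delta) -> (q != 0 -> 1 <= q ^+ 2 * Delta) ->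
  (r != 0 -> 1 <= r ^+ 2 * Gamma) -> (s != 0 -> 1 <= s ^+ 2 * Gamma) ->
  let Q := (q * r) ^+ 2 * (a' * b) + (p * s) ^+ 2 * (a * b') -
           2 * (p * s) * (q * r) * (c * d) in
  Q != 0 -> 1 <= Delta * Gamma * Q.
Proof.
move=> Delta Gamma a1 a'1 b1 b'1 D1 G1 hp hq hr hs Q Q0.
have mul1 (u v : R) : 1 <= u -> 1 <= v -> 1 <= u * v by nra.
have hx : p * s != 0 -> 1 <= Delta * Gamma * (p * s) ^+ 2.
  rewrite mulf_eq0 negb_or => /andP[/hp p1 /hs s1].
  rewrite (_ : _ * _ = p ^+ 2 * Delta * (s ^+ 2 * Gamma)); [exact: mul1|ring].
have hy : q * r != 0 -> 1 <= Delta * Gamma * (q * r) ^+ 2.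
  rewrite mulf_eq0 negb_or => /andP[/hq q1 /hr r1].
  rewrite (_ : _ * _ = q ^+ 2 * Delta * (r ^+ 2 * Gamma)); [exact: mul1|ring].
have DG1 : 1 <= Delta * Gamma by exact: mul1.
have a'b1 : 1 <= a' * b by exact: mul1.
have ab'1 : 1 <= a * b' by exact: mul1.
have [x0|x0] := eqVneq (p * s) 0.
  have y0 : q * r != 0.
    by apply: contra_neq Q0 => y0; rewrite /Q x0 y0; ring.
  rewrite (_ : _ * Q = Delta * Gamma * (q * r) ^+ 2 * (a' * b)).
    by apply: mul1 => //; exact: hy.
  by rewrite /Q x0; ring.
have [y0|y0] := eqVneq (q * r) 0.
  rewrite (_ : _ * Q = Delta * Gamma * (p * s) ^+ 2 * (a * b')).
    by apply: mul1 => //; exact: hx.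
  by rewrite /Q y0; ring.
have {hx}x1 := hx x0; have {hy}y1 := hy y0.
(* [z] is the geometric mean of the two quantities bounded in [x1] and [y1]. *)
pose z := Delta * Gamma * `|(p * s) * (q * r)|.
have z1 : 1 <= z.
  have z0 : 0 <= z by rewrite mulr_ge0 //; lra.
  rewrite -(@expr_ge1 _ 2) //.
  rewrite /z exprMn real_normK ?num_real //.
  have -> : (Delta * Gamma) ^+ 2 * (p * s * (q * r)) ^+ 2 =
            Delta * Gamma * (p * s) ^+ 2 * (Delta * Gamma * (q * r) ^+ 2) by ring.
  exact: mul1.
(* Since [a a' b b' >= (1 + c^2) (1 + d^2) >= (1 + w)^2], the product [U V] is at least
   [(z (1 + w))^2]. AM-GM then gives [U + V - 2 z w >= 2 z]. *)
pose U := Delta * Gamma * ((q * r) ^+ 2 * (a' * b)).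
pose V := Delta * Gamma * ((p * s) ^+ 2 * (a * b')).
pose w := `|c * d|.
have w0 : 0 <= w by exact: normr_ge0.
have QE : U + V - 2 * (z * w) <= Delta * Gamma * Q.
  have h := ler_norm ((p * s) * (q * r) * (c * d)); rewrite normrM in h.
  rewrite -subr_ge0 (_ : _ - _ = Delta * Gamma * 2 *
    (`|(p * s) * (q * r)| * `|c * d| - (p * s) * (q * r) * (c * d))).
    by apply: mulr_ge0; lra.
  by rewrite /Q /U /V /z /w; ring.
apply: le_trans _ QE.
have cd2 : 2 * w <= c ^+ 2 + d ^+ 2.
  rewrite /w normrM -[c ^+ 2]real_normK ?num_real // -[d ^+ 2]real_normK ?num_real //.
  by have := sqr_ge0 (`|c| - `|d|); rewrite sqrrB; lra.
have w2 : w ^+ 2 = c ^+ 2 * d ^+ 2 by rewrite /w real_normK ?num_real // exprMn.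
have PE : w ^+ 2 + 1 + 2 * w <= a * a' * (b * b').
  have -> : a * a' = Delta + c ^+ 2 by rewrite /Delta; ring.
  have -> : b * b' = Gamma + d ^+ 2 by rewrite /Gamma; ring.
  rewrite w2; have := sqr_ge0 c; have := sqr_ge0 d; nra.
have UV : U * V = z ^+ 2 * (a * a' * (b * b')).
  by rewrite /z exprMn real_normK ?num_real // /U /V; ring.
have U1 : 1 <= U by rewrite /U mulrA; exact: mul1.
have V1 : 1 <= V by rewrite /V mulrA; exact: mul1.
have UVge : (z * (w + 1)) ^+ 2 <= U * V.
  rewrite UV exprMn ler_pM2l ?exprn_gt0 ?(lt_le_trans ltr01) //.
  by apply: le_trans PE; rewrite sqrrD1 -mulr_natl addrAC.
have zw1 : 0 <= z * (w + 1) by rewrite mulr_ge0 ?addr_ge0 // (le_trans ler01).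
have := AGM2_le (le_trans ler01 U1) (le_trans ler01 V1) zw1 UVge.
by rewrite lerBrDr; apply: le_trans; rewrite mulrDr mulr1 mulrDr addrC lerD2l; lra.
Qed.

Lemma ord3_cases (i j l : 'I_3) : i != j -> i != l -> j != l ->
  forall h, [|| h == i, h == j | h == l].
Proof. by move=> + + + h; move: i j l h; do 4![case=> -[|[|[|//]]] ?]. Qed.

(** * Linear dependence of two or three vectors *)

Section Gram2Vec.
Variable R : realFieldType.

Definition gram2 n (u v : 'rV[R]_n) := dot u u * dot v v - dot u v ^+ 2.

Lemma gram2C n (u v : 'rV[R]_n) : gram2 u v = gram2 v u.
Proof. by rewrite /gram2 mulrC (dotC u v). Qed.

(** [gram2 u v] is [dot u u] times the squared norm of the part of [v] orthogonal to [u]. *)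
Lemma gram2_eq0 n (u v : 'rV[R]_n) :
  u != 0 -> gram2 u v = 0 -> v = (dot u v / dot u u) *: u.
Proof.
rewrite -dot_eq0 => u0 uv; apply/eqP; rewrite -subr_eq0 -dot_eq0 -scaleNr.
rewrite !(dotDl, dotDr, dotZl, dotZr) (dotC v u) -(mulrI_eq0 _ (lregP u0)).
by rewrite -[X in _ == X]uv /gram2; apply/eqP; field.
Qed.

Lemma det_gram2 n (u v : 'rV[R]_n) :
  \det (gram (\matrix_(i < 2) if i == 0 then u else v)) = gram2 u v.
Proof. by rewrite det_mx22 !gramE !rowK /= (dotC v u). Qed.

(** Each product is [u (x) (t_i f_i)] with [t_i] nonzero, so a relation [x] between the [f_i] gives
    the relation [x_i / t_i] between the products. *)
Lemma row_free_tens_rows_parallel N1 N2 k (E : 'M[R]_(k, N1)) (F : 'M[R]_(k, N2)) u t :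
  (forall i, row i E = t i *: u) -> row_free (tens_rows E F) -> row_free F.
Proof.
move=> Et hEF; have t0 i : t i != 0.
  apply/eqP => ti; have := row_free_row_neq0 i hEF.
  by rewrite rowK Et ti scale0r tens0v eqxx.
apply/row_free_kerP => x xF; move/row_free_kerP: hEF => /(_ (\row_i (x 0 i / t i))) h.
have /rowP x0 : \row_i (x 0 i / t i) = 0.
  apply: h; rewrite mulmx_sum_row.
  transitivity (\sum_i tensv u (x 0 i *: row i F)).
    apply: eq_bigr => i _; rewrite mxE rowK Et tensvZl tensvZr scalerA.
    by rewrite divfK.
  by rewrite -tensv_sumr -mulmx_sum_row xF tensv0.
apply/rowP => i; have := x0 i; rewrite !mxE => /eqP.
by rewrite mulf_eq0 invr_eq0 (negPf (t0 i)) orbF => /eqP.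
Qed.

Lemma span_of_not_row_free n (E : 'M[R]_(3, n)) (i j l : 'I_3) :
  ~~ row_free E -> i != j -> i != l -> j != l ->
  row i E != 0 -> gram2 (row i E) (row j E) != 0 ->
  exists p q, row l E = p *: row i E + q *: row j E.
Proof.
move=> /negP hE ij il jl Ei Eij.
have [c [cE c0]] : exists c : 'rV_3, c *m E = 0 /\ c != 0.
  apply: contra_notP hE => hE; apply/row_free_kerP => c cE.
  by apply/eqP/negPn/negP => c0; apply: hE; exists c.
have h3 := ord3_cases ij il jl.
have sum3 (V : zmodType) (G : 'I_3 -> V) : \sum_h G h = G i + G j + G l.
  rewrite (bigD1 i) //= (bigD1 j) 1?eq_sym //= (bigD1 l) /=; last first.
    by rewrite ![l == _]eq_sym il jl.
  rewrite big1 ?addr0 ?addrA // => h /andP[/andP[/negPf hi /negPf hj] /negPf hl].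
  by have := h3 h; rewrite hi hj hl.
move: cE; rewrite mulmx_sum_row sum3 => cE.
(* Otherwise the relation involves rows [i] and [j] only, against their independence. *)
have cl : c 0 l != 0.
  apply/eqP => cl; rewrite cl scale0r addr0 in cE.
  have cj : c 0 j = 0.
    apply/eqP; apply: contraNT Eij => cj.
    have -> : row j E = - (c 0 i / c 0 j) *: row i E.
      apply: (scalerI cj); rewrite scalerA mulrN mulrC divfK // scaleNr.
      by apply/eqP; rewrite -addr_eq0 addrC cE.
    by rewrite /gram2 !(dotZl, dotZr); apply/eqP; ring.
  rewrite cj scale0r addr0 in cE; move/eqP: cE.
  rewrite scaler_eq0 (negPf Ei) orbF => /eqP ci.
  case/eqP: c0; apply/rowP => h; rewrite mxE.
  by case/or3P: (h3 h) => /eqP->.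
exists (- (c 0 i / c 0 l)), (- (c 0 j / c 0 l)); apply: (scalerI cl).
rewrite scalerDr !scalerA !mulrN ![c 0 l * _]mulrC !divfK // !scaleNr -opprD.
by apply/eqP; rewrite -addr_eq0 addrC cE.
Qed.

End Gram2Vec.

Section PureTensors.
Variable R : realType.

Lemma covol_ge1_dot n N (B : 'M[R]_(n, N)) x :
  covol_ge1 B -> in_lattice B x -> x != 0 -> 1 <= dot x x.
Proof.
move=> [_ hB] xB x0; rewrite -det_gram1; apply: hB; split.
  by rewrite row_free_det det_gram1 dot_eq0.
by move=> i; rewrite row_id.
Qed.

Lemma covol_ge1_gram2 n N (B : 'M[R]_(n, N)) u v :
  covol_ge1 B -> in_lattice B u -> in_lattice B v -> gram2 u v != 0 ->
  1 <= gram2 u v.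
Proof.
move=> [_ hB] uB vB uv; rewrite -det_gram2; apply: hB; split.
  by rewrite row_free_det det_gram2.
by move=> i; rewrite rowK; case: ifP.
Qed.

(** The determinant of a symmetric [G] with its indices reordered as [i, j, l], so that any two of
    them can serve as the independent pair. *)
Definition gram3 (G : 'M[R]_3) i j l :=
  G i i * (G j j * G l l - G j l ^+ 2) - G i j * (G i j * G l l - G j l * G i l)
  + G i l * (G i j * G j l - G j j * G i l).

(** With [e_l = p e_i + q e_j], the Gram determinant of [(e_l, e_j)] is [p^2] times that of
    [(e_i, e_j)], hence at least 1 when [p] is nonzero. The same for [q], [r], [s] supplies the
    hypotheses of [planar_bound]. *)
Lemma planar_tensors n1 N1 n2 N2 (B1 : 'M[R]_(n1, N1)) (B2 : 'M[R]_(n2, N2))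
    (E : 'M[R]_(3, N1)) (F : 'M[R]_(3, N2)) (i j l : 'I_3) :
  covol_ge1 B1 -> covol_ge1 B2 ->
  (forall h, in_lattice B1 (row h E)) -> (forall h, in_lattice B2 (row h F)) ->
  (forall h, row h E != 0) -> (forall h, row h F != 0) ->
  ~~ row_free E -> ~~ row_free F ->
  i != j -> i != l -> j != l ->
  gram2 (row i E) (row j E) != 0 -> gram2 (row i F) (row j F) != 0 ->
  gram3 (gram (tens_rows E F)) i j l != 0 ->
  1 <= gram3 (gram (tens_rows E F)) i j l.
Proof.
move=> hB1 hB2 EB FB E0 F0 nE nF ij il jl Eij Fij.
have [p [q El]] := span_of_not_row_free nE ij il jl (E0 i) Eij.
have [r [s Fl]] := span_of_not_row_free nF ij il jl (F0 i) Fij.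
have D1 := covol_ge1_gram2 hB1 (EB i) (EB j) Eij.
have G1 := covol_ge1_gram2 hB2 (FB i) (FB j) Fij.
have a1 := covol_ge1_dot hB1 (EB i) (E0 i).
have a'1 := covol_ge1_dot hB1 (EB j) (E0 j).
have b1 := covol_ge1_dot hB2 (FB i) (F0 i).
have b'1 := covol_ge1_dot hB2 (FB j) (F0 j).
have gl N (x y : 'rV[R]_N) t u : gram2 (t *: x + u *: y) y = t ^+ 2 * gram2 x y.
  by rewrite /gram2 !(dotDl, dotDr, dotZl, dotZr) (dotC y x); ring.
have gr N (x y : 'rV[R]_N) t u : gram2 x (t *: x + u *: y) = u ^+ 2 * gram2 x y.
  by rewrite /gram2 !(dotDl, dotDr, dotZl, dotZr) (dotC y x); ring.
have hp : p != 0 -> 1 <= p ^+ 2 * gram2 (row i E) (row j E).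
  move=> p0; rewrite -(gl _ _ _ p q) -El; apply: covol_ge1_gram2 hB1 _ _ _ => //.
  by rewrite El gl mulf_neq0 // sqrf_eq0.
have hq : q != 0 -> 1 <= q ^+ 2 * gram2 (row i E) (row j E).
  move=> q0; rewrite -(gr _ _ _ p q) -El; apply: covol_ge1_gram2 hB1 _ _ _ => //.
  by rewrite El gr mulf_neq0 // sqrf_eq0.
have hr : r != 0 -> 1 <= r ^+ 2 * gram2 (row i F) (row j F).
  move=> r0; rewrite -(gl _ _ _ r s) -Fl; apply: covol_ge1_gram2 hB2 _ _ _ => //.
  by rewrite Fl gl mulf_neq0 // sqrf_eq0.
have hs : s != 0 -> 1 <= s ^+ 2 * gram2 (row i F) (row j F).
  move=> s0; rewrite -(gr _ _ _ r s) -Fl; apply: covol_ge1_gram2 hB2 _ _ _ => //.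
  by rewrite Fl gr mulf_neq0 // sqrf_eq0.
have := planar_bound a1 a'1 b1 b'1 D1 G1 hp hq hr hs.
rewrite /gram3 !gram_tens_rows !gramE El Fl !(dotDl, dotDr, dotZl, dotZr).
rewrite (dotC (row j E) (row i E)) (dotC (row j F) (row i F)).
set a := dot (row i E) (row i E); set a' := dot (row j E) (row j E).
set b := dot (row i F) (row i F); set b' := dot (row j F) (row j F).
set c := dot (row i E) (row j E); set d := dot (row i F) (row j F).
cbv zeta; set Q := _ - _ * (c * d); move=> hQ.
set T := (X in X != 0); have TE : T = (a * a' - c ^+ 2) * (b * b' - d ^+ 2) * Q.
  by rewrite /T /Q; ring.
rewrite -/T TE => Q0; apply: hQ.
by apply: contra_neq Q0 => ->; rewrite mulr0.
Qed.

Lemma pure_tensors_det_ge1 n1 N1 n2 N2 (B1 : 'M[R]_(n1, N1)) (B2 : 'M[R]_(n2, N2)) k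
    (E : 'M[R]_(k, N1)) (F : 'M[R]_(k, N2)) :
  covol_ge1 B1 -> covol_ge1 B2 -> (k <= 3)%N ->
  (forall h, in_lattice B1 (row h E)) -> (forall h, in_lattice B2 (row h F)) ->
  row_free (tens_rows E F) -> 1 <= \det (gram (tens_rows E F)).
Proof.
move=> hB1 hB2 k3 EB FB EF.
have E0 h : row h E != 0.
  apply/eqP => h0; have := row_free_row_neq0 h EF.
  by rewrite rowK h0 tens0v eqxx.
have F0 h : row h F != 0.
  apply/eqP => h0; have := row_free_row_neq0 h EF.
  by rewrite rowK h0 tensv0 eqxx.
have EF' : row_free (tens_rows F E).
  by rewrite row_free_det -gram_tens_rowsC -row_free_det.
have [fF|nF] := boolP (row_free F).
  apply: le_trans _ (Oppenheim fF EF); apply: le_trans (hB2.2 _ F _) _ => //.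
  apply: ler_peMr; first exact/ltW/det_gram_gt0.
  apply: (big_ind (fun x => 1 <= x)) => // [x y|h _]; first exact: mulr_ege1.
  exact: covol_ge1_dot hB1 _ _.
have [fE|nE] := boolP (row_free E).
  rewrite gram_tens_rowsC; apply: le_trans _ (Oppenheim fE EF').
  apply: le_trans (hB1.2 _ E _) _ => //.
  apply: ler_peMr; first exact/ltW/det_gram_gt0.
  apply: (big_ind (fun x => 1 <= x)) => // [x y|h _]; first exact: mulr_ege1.
  exact: covol_ge1_dot hB2 _ _.
(* If all rows of [E] were parallel to one of them, [F] would be independent. *)
have nEpar i : ~ (forall j, gram2 (row i E) (row j E) = 0).
  move=> par; move/negP: nF; apply.
  apply: (row_free_tens_rows_parallel _ EF) => j; exact: gram2_eq0 (E0 i) (par j).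
have nFpar i : ~ (forall j, gram2 (row i F) (row j F) = 0).
  move=> par; move/negP: nE; apply.
  apply: (row_free_tens_rows_parallel _ EF') => j; exact: gram2_eq0 (F0 i) (par j).
have g2xx n (x : 'rV[R]_n) : gram2 x x = 0 by rewrite /gram2 expr2 subrr.
case: k k3 => [|[|[|[|//]]]] _ in E F EB FB EF E0 F0 EF' nF nE nEpar nFpar *.
- by rewrite det_mx00.
- by case: (nEpar 0) => j; rewrite [j]ord1 g2xx.
(* In rank 2 the dependence of [E] makes its only pair of rows parallel, which [nEpar] excludes. *)
- have [Ed|] := eqVneq (\det (gram E)) 0; last by rewrite -row_free_det (negPf nE).
  case: (nEpar 0) => j; case: j => [[|[|//]] jlt].
    by rewrite [Ordinal _](_ : _ = 0) ?g2xx //; apply: val_inj.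
  rewrite [Ordinal _](_ : _ = 1); last exact: val_inj.
  by rewrite -[RHS]Ed det_mx22 !gramE /gram2 [dot (row 1 E) (row 0 E)]dotC.
have Gsym i j : gram (tens_rows E F) i j = gram (tens_rows E F) j i.
  by rewrite !gramE dotC.
have dG i j l : i != j -> i != l -> j != l ->
    \det (gram (tens_rows E F)) = gram3 (gram (tens_rows E F)) i j l.
  rewrite det_mx33 /gram3.
  rewrite (Gsym 1 0) (Gsym 2%:R 0) (Gsym 2%:R 1).
  have o0 (h : (0 < 3)%N) : Ordinal h = 0 by apply: val_inj.
  have o1 (h : (1 < 3)%N) : Ordinal h = 1 by apply: val_inj.
  have o2 (h : (2 < 3)%N) : Ordinal h = 2%:R by apply: val_inj.
  case: i j l => [[|[|[|//]]] hi] [[|[|[|//]]] hj] [[|[|[|//]]] hl] //= _ _ _;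
    rewrite ?o0 ?o1 ?o2 ?(Gsym 1 0) ?(Gsym 2%:R 0) ?(Gsym 2%:R 1); ring.
have key i j l : i != j -> i != l -> j != l ->
    gram2 (row i E) (row j E) != 0 -> gram2 (row i F) (row j F) != 0 ->
    1 <= \det (gram (tens_rows E F)).
  move=> ij il jl Eij Fij; rewrite (dG i j l) //.
  by apply: (planar_tensors hB1 hB2) => //; rewrite -dG // -row_free_det.
have two n (A : 'M[R]_(3, n)) i j l : i != j -> i != l -> j != l ->
    ~ (forall h, gram2 (row i A) (row h A) = 0) ->
    gram2 (row i A) (row j A) = 0 -> gram2 (row i A) (row l A) != 0.
  move=> ij il jl npar Aij; apply/eqP => Ail; apply: npar => h.
  by case/or3P: (ord3_cases ij il jl h) => /eqP ->.
(* Two parallel pairs would share a row, making the whole family parallel to it. So each family has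
   at most one parallel pair, and one of the three pairs is independent in both. *)
have [E01|E01] := eqVneq (gram2 (row 0 E) (row 1 E)) 0.
  have E02 : gram2 (row 0 E) (row 2%:R E) != 0 by apply: two E01.
  have E12 : gram2 (row 1 E) (row 2%:R E) != 0.
    by rewrite gram2C in E01; apply: two E01.
  have [F02|F02] := eqVneq (gram2 (row 0 F) (row 2%:R F)) 0; last exact: (key 0 2%:R 1).
  have F12 : gram2 (row 1 F) (row 2%:R F) != 0.
    by rewrite gram2C in F02; rewrite gram2C; apply: two F02.
  exact: (key 1 2%:R 0).
have [F01|F01] := eqVneq (gram2 (row 0 F) (row 1 F)) 0; last exact: (key 0 1 2%:R).
have F02 : gram2 (row 0 F) (row 2%:R F) != 0 by apply: two F01.
have F12 : gram2 (row 1 F) (row 2%:R F) != 0.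
  by rewrite gram2C in F01; apply: two F01.
have [E02|E02] := eqVneq (gram2 (row 0 E) (row 2%:R E)) 0; last exact: (key 0 2%:R 1).
have E12 : gram2 (row 1 E) (row 2%:R E) != 0.
  by rewrite gram2C in E02; rewrite gram2C; apply: two E02.
exact: (key 1 2%:R 0).
Qed.

End PureTensors.

(** * Bases of least total squared norm *)

Section Minimal.
Variable R : realType.

Lemma row_free_tens m n p q (A : 'M[R]_(m, n)) (B : 'M[R]_(p, q)) :
  row_free A -> row_free B -> row_free (A *t B).
Proof.
move=> /row_freeP[X AX] /row_freeP[Y BY]; apply/row_freeP; exists (X *t Y).
rewrite tensmx_mul AX BY; apply/matrixP => i j.
case: (mxtens_indexP i) => a b; case: (mxtens_indexP j) => c d.
rewrite tensmxE !mxE (can_eq (@mxtens_indexK _ _)) xpair_eqE.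
by case: eqP => _; rewrite ?mul1r ?mul0r.
Qed.

Lemma is_sublattice_basisP k n N (C : 'M[R]_(k, N)) (B : 'M[R]_(n, N)) :
  is_sublattice_basis C B ->
  row_free C /\ exists Z : 'M[int]_(k, n), C = map_mx intr Z *m B.
Proof.
case=> hC /fin_all_exists[z zE]; split=> //; exists (\matrix_i z i).
by apply/row_matrixP => i; rewrite row_mul -map_row rowK zE.
Qed.

Definition sqnorm_rows k N (C : 'M[R]_(k, N)) : R := \sum_i dot (row i C) (row i C).

(** A right inverse [X] of [B] recovers [Z] from [Z B], whose entries have square at most [T];
    bounding them by [1 + T] avoids a square root. *)
Lemma short_vectors_bounded k n N (B : 'M[R]_(n, N)) (T : R) : row_free B ->
  exists K : nat, forall Z : 'M[int]_(k, n),
    sqnorm_rows (map_mx intr Z *m B) <= T -> forall i j, (`|Z i j| <= K)%N.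
Proof.
move=> /row_freeP[X BX]; pose M := (1 + T) * \sum_l \sum_j `|X l j|.
exists (Num.bound M) => Z hZ i j; set C := map_mx intr Z *m B in hZ.
have ZE : map_mx intr Z = C *m X by rewrite -mulmxA BX mulmx1.
have hC l : `|C i l| <= 1 + T.
  have : C i l ^+ 2 <= T.
    apply: le_trans hZ; rewrite /sqnorm_rows (bigD1 i) //= dotE (bigD1 l) //=.
    rewrite !mxE -expr2 -addrA lerDl addr_ge0 // sumr_ge0 // => h _.
      by rewrite -expr2 sqr_ge0.
    exact: dot_ge0.
  rewrite -[C i l ^+ 2]real_normK ?num_real //.
  by have := sqr_ge0 (`|C i l| - 1); have := normr_ge0 (C i l); rewrite sqrrB; nra.
have T0 : 0 <= 1 + T.
  rewrite addr_ge0 //; apply: le_trans hZ; apply: sumr_ge0 => h _; exact: dot_ge0.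
have M0 : 0 <= M by rewrite mulr_ge0 // !sumr_ge0 // => l _; rewrite sumr_ge0.
have : (`|Z i j|%N)%:R <= M.
  have -> : (`|Z i j|%N)%:R = `|map_mx intr Z i j| :> R.
    by rewrite mxE -intr_norm -abszE.
  rewrite ZE mxE; apply: le_trans (ler_norm_sum _ _ _) _.
  rewrite /M mulr_sumr ler_sum // => l _; rewrite normrM ler_pM //.
  by rewrite (bigD1 j) //= lerDl sumr_ge0.
move/le_lt_trans/(_ (archi_boundP M0)); rewrite ltr_nat; exact: ltnW.
Qed.

Lemma ex_min_sqnorm k n N (B : 'M[R]_(n, N)) (P : 'M[int]_(k, n) -> Prop) :
  row_free B -> (exists Z, P Z) ->
  exists Z, P Z /\ forall Z', P Z' ->
    sqnorm_rows (map_mx intr Z *m B) <= sqnorm_rows (map_mx intr Z' *m B).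
Proof.
move=> hB [Z0 P0]; pose f (Z : 'M[int]_(k, n)) := sqnorm_rows (map_mx intr Z *m B).
have [K hK] := short_vectors_bounded k (f Z0) hB.
(* Matrices with entries in [[-K, K]] are indexed by a finite type, so the minimum becomes a finite
   search. *)
pose dec (W : 'M['I_(K + K).+1]_(k, n)) : 'M[int]_(k, n) :=
  \matrix_(i, j) ((W i j : nat)%:Z - K%:Z).
have decP Z : f Z <= f Z0 -> exists W, Z = dec W.
  move=> /hK ZK; exists (\matrix_(i, j) inord `|(Z i j + K%:Z)%R|%N).
  apply/matrixP => i j; rewrite !mxE inordK; have := ZK i j; lia.
have [W0 W0E] := decP Z0 (lexx _).
pose p := [pred W | `[< P (dec W) >]].
have PW0 : p W0 by apply/asboolP; rewrite -W0E.
case: (@arg_minP _ _ _ W0 p (fun W => f (dec W)) PW0) => W /asboolP PW minW.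
exists (dec W); split=> // Z' PZ'.
have [/decP[W' W'E]|fZ'] := leP (f Z') (f Z0).
  by rewrite W'E; apply: minW; apply/asboolP; rewrite -W'E.
by apply: le_trans (ltW fZ'); rewrite W0E; exact: minW.
Qed.


Lemma sqnorm_rows_col k N (v : 'rV[R]_N) (V : 'M[R]_(k, N)) :
  sqnorm_rows (col_mx v V : 'M[R]_(1 + k, N)) = dot v v + sqnorm_rows V.
Proof.
rewrite /sqnorm_rows big_split_ord big_ord1 /= rowKu row_id; congr (_ + _).
by apply: eq_bigr => i _; rewrite rowKd.
Qed.

(* The orthogonal part of [v] is reached, up to [k / 4] times the squared norm of the
   longest row, by translating [v] along the other rows. *)
Lemma longest_row_le k n N (B : 'M[R]_(n, N)) (z : 'rV[int]_n) (Z : 'M[int]_(k, n)) :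
  let C := map_mx intr (col_mx z Z : 'M[int]_(1 + k, n)) *m B in
  (forall z', let C' := map_mx intr (col_mx (z + z' *m Z) Z : 'M[int]_(1 + k, n)) *m B in
    sqnorm_rows C <= sqnorm_rows C') ->
  (forall i, dot (row i C) (row i C) <= dot (row 0 C) (row 0 C)) ->
  row_free C -> 1 <= \det (gram (map_mx intr Z *m B)) ->
  (1 - k%:R / 4) * dot (row 0 C) (row 0 C) <= \det (gram C).
Proof.
rewrite /=; set V := map_mx intr Z *m B; set v := map_mx intr z *m B.
have CE z' : map_mx intr (col_mx (z + z' *m Z) Z : 'M[int]_(1 + k, n)) *m B =
             col_mx (v + map_mx intr z' *m V) V.
  by rewrite map_col_mx mul_col_mx map_mxD map_mxM mulmxDl -mulmxA.
have C0 : map_mx intr (col_mx z Z : 'M[int]_(1 + k, n)) *m B = col_mx v V.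
  by rewrite map_col_mx mul_col_mx.
have r0 : row 0 (col_mx v V : 'M[R]_(1 + k, N)) = v.
  by rewrite -[RHS](row_id 0) -(rowKu 0 v V); congr row; apply: val_inj.
rewrite C0 r0 => hmin hmax vV V1.
have hV := row_free_dsub vV; have [c [y [vE yV]]] := ortho_decomp v hV.
have [z' hz'] := lattice_rounding V y c.
have {hmin} : dot v v <= dot y y + 4^-1 * sqnorm_rows V.
  have := hmin z'; rewrite CE !sqnorm_rows_col lerD2r => /le_trans; apply.
  by apply: le_trans hz'; rewrite vE mulmxDl addrAC addrA addrAC (addrC y).
have : sqnorm_rows V <= k%:R * dot v v.
  rewrite mulr_natl -[X in _ *+ X](card_ord k) -sumr_const; apply: ler_sum => i _.
  by have := hmax (rshift 1 i); rewrite rowKd.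
move=> h1 h2; have -> : \det (gram (col_mx v V)) = dot y y * \det (gram V).
  by rewrite vE addrC det_gram_add det_gram_ortho.
apply: (@le_trans _ _ (dot y y)); first lra.
by rewrite ler_peMr // dot_ge0.
Qed.

Lemma tensor_covol_ge1 n1 N1 n2 N2 (B1 : 'M[R]_(n1, N1)) (B2 : 'M[R]_(n2, N2)) k
    (C : 'M[R]_(k, N1 * N2)) :
  covol_ge1 B1 -> covol_ge1 B2 -> (k <= 3)%N ->
  is_sublattice_basis C (lat_tensor B1 B2) -> 1 <= \det (gram C).
Proof.
move=> hB1 hB2; set B := lat_tensor B1 B2.
have hB : row_free B by apply: row_free_tens; [exact: hB1.1 | exact: hB2.1].
elim: k C => [|k IH] C k3 hC; first by rewrite det_mx00.
rewrite leNgt; apply/negP => dC.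
(* The minimum runs over bases of all sublattices of rank [k.+1] with squared covolume below 1, not
   only over bases of the lattice of [C]. *)
pose P (Z : 'M[int]_(k.+1, n1 * n2)) := row_free (map_mx intr Z *m B) /\
  \det (gram (map_mx intr Z *m B)) < 1.
have [|Z [[fZ dZ] minZ]] := @ex_min_sqnorm k.+1 _ _ B P hB.
  by have [fC [Z CE]] := is_sublattice_basisP hC; exists Z; rewrite /P -CE.
set D := map_mx intr Z *m B in fZ dZ minZ.
have DB i : in_lattice B (row i D) by apply: in_lattice_mul.
have short i : dot (row i D) (row i D) < 2.
  case: (@arg_maxP _ _ _ ord0 predT (fun i => dot (row i D) (row i D)) isT) => m _ maxm.
  apply: le_lt_trans (maxm i isT) _.
  (* A transposition moves the longest row to the front; the total squared norm and the Gram
     determinant do not change. *)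
  pose s := tperm 0 m; pose Z' := row_perm s Z.
  have Z'D : map_mx intr Z' *m B = row_perm s D.
    by rewrite map_row_perm !row_permE mulmxA.
  have Z'r i' : row i' (map_mx intr Z' *m B) = row (s i') D.
    by rewrite Z'D; apply/rowP => j; rewrite !mxE.
  have dZ' : \det (gram (map_mx intr Z' *m B)) = \det (gram D).
    by rewrite Z'D row_permE det_gram_mul det_perm sqrr_sign mul1r.
  have sZ' : sqnorm_rows (map_mx intr Z' *m B) = sqnorm_rows D.
    rewrite /sqnorm_rows [RHS](reindex_inj (@perm_inj _ s)).
    by apply: eq_bigr => i' _; rewrite Z'r.
  have fZ' : row_free (map_mx intr Z' *m B).
    by rewrite row_free_det dZ' -row_free_det.
  have r0 : row 0 (map_mx intr Z' *m B) = row m D by rewrite Z'r tpermL.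
  move: Z' dZ' sZ' fZ' r0 Z'r {Z'D}; rewrite -[k.+1]/(1 + k)%N => Z'.
  rewrite -[Z']vsubmxK; move: (usubmx Z') (dsubmx Z') => z {}Z' dZ' sZ' fZ' r0 Z'r.
  have V1 : 1 <= \det (gram (map_mx intr Z' *m B)).
    apply: IH; first exact: ltnW.
    apply: is_sublattice_basis_mul => //; apply: (@row_free_mull _ _ _ _ _ B).
    by apply: row_free_dsub; move: fZ'; rewrite map_col_mx mul_col_mx; apply.
  have := @longest_row_le k _ _ B z Z'; rewrite /= r0 dZ' sZ' => /(_ _ _ fZ' V1) h.
  have : (1 - k%:R / 4) * dot (row m D) (row m D) <= \det (gram D).
    apply: h => [z'|i']; last by rewrite Z'r; apply: maxm.
    apply: minZ.
    have E : map_mx intr (col_mx (z + z' *m Z') Z' : 'M[int]_(1 + k, _)) *m B =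
        col_mx (map_mx intr z *m B + map_mx intr z' *m (map_mx intr Z' *m B))
               (map_mx intr Z' *m B).
      by rewrite map_col_mx mul_col_mx map_mxD map_mxM mulmxDl -mulmxA.
    move: fZ' dZ'; rewrite map_col_mx mul_col_mx => fZ' dZ'.
    by rewrite /P E; split; [apply: row_free_add | rewrite det_gram_add dZ'].
  (* The factor [1 - k / 4] is thus at least 1/2, and a Gram determinant below 1 forces squared norm
     below 2. *)
  have k2 : (k%:R : R) <= 2 by rewrite ler_nat.
  have := dot_ge0 (row m D); nra.
have pure i : exists ef : 'rV_N1 * 'rV_N2,
    [/\ in_lattice B1 ef.1, in_lattice B2 ef.2 & row i D = tensv ef.1 ef.2].
  have [[e [f ef]]|] := tensor_lattice_vector hB1 hB2 (DB i) (row_free_row_neq0 i fZ).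
    by exists (e, f).
  by rewrite leNgt short.
have [ef hef] := fin_all_exists pure.
pose E := \matrix_i (ef i).1; pose F := \matrix_i (ef i).2.
have DE : D = tens_rows E F.
  by apply/row_matrixP => i; rewrite !rowK; have [] := hef i.
move: dZ; rewrite ltNge DE => /negP; apply.
apply: (pure_tensors_det_ge1 hB1 hB2 k3); rewrite -?DE // => i.
  by rewrite rowK; have [] := hef i.
by rewrite rowK; have [] := hef i.
Qed.

End Minimal.

(** * Slopes *)

Section DetTens.
Variable R : comNzRingType.

Lemma det_castmx m n (e : m = n) (A : 'M[R]_m) : \det (castmx (e, e) A) = \det A.
Proof. by case: n / e. Qed.

(** Two sizes are kept because the swap of tensor factors goes from [m * n] to [n * m], which are
    not convertible. *)
Lemma det_mxsub_inj m n (f : 'I_m -> 'I_n) (A : 'M[R]_n) :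
  m = n -> injective f -> \det (mxsub f f A) = \det A.
Proof.
move=> mn; case: n / mn in f A *; move=> f_inj.
have -> : mxsub f f A = row_perm (perm f_inj) (col_perm (perm f_inj) A).
  by apply/matrixP => i j; rewrite !mxE !permE.
rewrite row_permE col_permE !det_mulmx !det_perm odd_permV.
by rewrite mulrCA -expr2 sqrr_sign mulr1.
Qed.

Lemma det_tens1mx m n (B : 'M[R]_n) : \det ((1%:M : 'M[R]_m) *t B) = \det B ^+ m.
Proof.
elim: m => [|m IH]; first by rewrite det_mx00 expr0.
rewrite -[m.+1]/(1 + m)%N scalar_mx_block tens_block_mx det_castmx !tens0mx.
by rewrite det_ublock IH tens_scalar_mx det_castmx scale1r exprS.
Qed.

(** Factor [A *t B] as [(A *t 1) (1 *t B)]; exchanging the two indices turns [A *t 1] into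
    [1 *t A]. *)
Lemma det_tensmx m n (A : 'M[R]_m) (B : 'M[R]_n) :
  \det (A *t B) = \det A ^+ n * \det B ^+ m.
Proof.
rewrite -[A]mulmx1 -[B]mul1mx -tensmx_mul det_mulmx det_tens1mx mul1mx mulmx1.
congr (_ * _); rewrite -det_tens1mx.
pose f (i : 'I_(m * n)) := mxtens_index ((mxtens_unindex i).2, (mxtens_unindex i).1).
transitivity (\det (mxsub f f ((1%:M : 'M[R]_n) *t A))).
  congr (\det _); apply/matrixP => i j.
  by rewrite !mxE !mxtens_indexK /= mulrC.
apply: det_mxsub_inj; first exact: mulnC.
move=> i j; move/(can_inj (@mxtens_indexK _ _)) => [] h2 h1.
rewrite -[i]mxtens_unindexK -[j]mxtens_unindexK; congr mxtens_index.
by congr (_, _); apply: val_inj.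
Qed.

End DetTens.

Section Slopes.
Variable R : realType.

Lemma lat_slopeE n N (B : 'M[R]_(n, N)) : row_free B ->
  lat_slope B = - ln (\det (gram B)) / (2 * n%:R).
Proof.
move=> hB; rewrite /lat_slope /lat_deg /lat_vol -/(gram B) invfM mulrA; congr (_ / _).
have d0 := det_gram_gt0 hB; rewrite mulNr; congr (- _).
rewrite -[in RHS](sqr_sqrtr (ltW d0)) lnXn ?sqrtr_gt0 //.
by rewrite -[_ *+ 2]mulr_natr mulfK // pnatr_eq0.
Qed.

Lemma row_free_scale m n a (A : 'M[R]_(m, n)) : a != 0 -> row_free (a *: A) = row_free A.
Proof. by move=> a0; rewrite /row_free mxrank_scale_nz. Qed.

Lemma ln_det_gram_scale m n mu (A : 'M[R]_(m, n)) : row_free A ->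
  ln (\det (gram (expR mu *: A))) = 2 * m%:R * mu + ln (\det (gram A)).
Proof.
move=> hA; have d0 := det_gram_gt0 hA.
rewrite /gram linearZ /= -scalemxAl -scalemxAr scalerA detZ -/(gram A).
rewrite lnM ?posrE ?exprn_gt0 ?mulr_gt0 ?expR_gt0 // lnXn ?mulr_gt0 ?expR_gt0 //.
by rewrite -expRD expRK -mulr_natr; ring.
Qed.

Lemma is_sublattice_basis_scale k n N a (C : 'M[R]_(k, N)) (B : 'M[R]_(n, N)) :
  a != 0 -> is_sublattice_basis C B -> is_sublattice_basis (a *: C) (a *: B).
Proof.
move=> a0 [fC CB]; split=> [|i]; first by rewrite row_free_scale.
have [z zE] := CB i; exists z; rewrite -scalemxAr -zE.
by apply/rowP => j; rewrite !mxE.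
Qed.

(** Scaling by [expR mu] lowers every slope by [mu]; with [mu] the slope of [B], the semistability
    bound becomes 0. *)
Lemma semistable_covol_ge1 n N (B : 'M[R]_(n, N)) :
  semistable B -> covol_ge1 (expR (lat_slope B) *: B).
Proof.
move=> [hB ssB]; have e0 : expR (lat_slope B) != 0 by rewrite gt_eqF ?expR_gt0.
split=> [|k C hC]; first by rewrite row_free_scale.
have := is_sublattice_basis_scale (invr_neq0 e0) hC.
rewrite scalerA mulVf // scale1r => hC'.
have -> : C = expR (lat_slope B) *: ((expR (lat_slope B))^-1 *: C).
  by rewrite scalerA divff // scale1r.
move: (_^-1 *: C) hC' => {hC}C hC; have fC := hC.1.
case: k C hC fC => [|k] C hC fC; first by rewrite det_mx00.
have := ssB _ C isT hC; rewrite (lat_slopeE fC).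
rewrite ler_pdivrMr ?mulr_gt0 ?ltr0n // => h.
rewrite -ler_ln ?posrE ?det_gram_gt0 ?row_free_scale // ln1 ln_det_gram_scale //.
by lra.
Qed.

(** The logarithm of the Kronecker determinant is [n2] and [n1] times those of the factors. Positive
    ranks are required since division by 0 would make the left side 0. *)
Lemma lat_slope_tensor n1 N1 n2 N2 (B1 : 'M[R]_(n1, N1)) (B2 : 'M[R]_(n2, N2)) :
  row_free B1 -> row_free B2 -> (0 < n1 * n2)%N ->
  lat_slope (lat_tensor B1 B2) = lat_slope B1 + lat_slope B2.
Proof.
rewrite muln_gt0 => h1 h2 /andP[n1_gt0 n2_gt0].
rewrite !lat_slopeE //; last exact: row_free_tens.
have -> : \det (gram (lat_tensor B1 B2)) = \det (gram B1) ^+ n2 * \det (gram B2) ^+ n1.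
  by rewrite /gram trmx_tens tensmx_mul det_tensmx.
have d1 := det_gram_gt0 h1; have d2 := det_gram_gt0 h2.
rewrite lnM ?posrE ?exprn_gt0 // !lnXn // natrM -[_ *+ n2]mulr_natr -[_ *+ n1]mulr_natr.
by field; rewrite ?pnatr_eq0 -?lt0n ?n1_gt0 ?n2_gt0.
Qed.

End Slopes.

Theorem theorem1 (R : realType) (n1 N1 n2 N2 : nat)
  (B1 : 'M[R]_(n1, N1)) (B2 : 'M[R]_(n2, N2))
  (k : nat) (C : 'M[R]_(k, N1 * N2)) :
  semistable B1 -> semistable B2 ->
  (0 < k)%N -> (k <= 3)%N ->
  is_sublattice_basis C (lat_tensor B1 B2) ->
  lat_slope C <= lat_slope (lat_tensor B1 B2).
Proof.
move=> ss1 ss2 k0 k3 hC; have fC := hC.1.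
(* The [k > 0] independent rows have integer coordinate rows of length [n1 * n2]. *)
have n12 : (0 < n1 * n2)%N.
  have [_ [Z CE]] := is_sublattice_basisP hC.
  move: fC; rewrite CE => /row_free_mull /eqP rZ.
  by apply: leq_trans k0 _; rewrite -rZ rank_leq_col.
rewrite lat_slope_tensor //; [|exact: ss1.1|exact: ss2.1].
set m1 := lat_slope B1; set m2 := lat_slope B2.
have e0 : expR (m1 + m2) != 0 by rewrite gt_eqF ?expR_gt0.
have := is_sublattice_basis_scale e0 hC.
(* This scaling of the tensor product brings both factors to slope 0. *)
have -> : expR (m1 + m2) *: lat_tensor B1 B2 = lat_tensor (expR m1 *: B1) (expR m2 *: B2).
  by apply/matrixP => i j; rewrite !mxE expRD; ring.
move/(tensor_covol_ge1 (semistable_covol_ge1 ss1) (semistable_covol_ge1 ss2) k3).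
move/ln_ge0.
rewrite ln_det_gram_scale // => h.
rewrite (lat_slopeE fC) ler_pdivrMr ?mulr_gt0 ?ltr0n //; lra.
Qed.
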